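(* Let $\rho\in\mathcal{D}(\mathbb{C}^2)$ be a known nominal qubit state and $\alpha\in(0,1)$. Consider the one-sample quantum universal hypothesis testing problem: given $\sigma^{\otimes m}$ for an unknown $\sigma\in\mathcal{D}(\mathbb{C}^2)$, test $H_0:\sigma=\rho$ against $H_1:\sigma\neq\rho$. Then there exist decision rules $M_m$ (depending only on $\rho$, $\alpha$ and $m$, not on $\sigma$), using only independent measurements, such that for all sufficiently large $m$, $\alpha(M_m)\le\alpha$, and for every fixed $\sigma\neq\rho$ there is a constant $K$ (which may depend on $\rho,\sigma,\alpha$) such that for all sufficiently large $m$, $$\beta(M_m)\le\exp\!\left(-\frac{m\|\rho-\sigma\|_1^2}{54}+K m^{1/2}\right).$$
   Context: $\mathcal{D}(\mathcal{H})$ denotes the set of density operators on $\mathcal{H}$. A decision rule $M_m$ is a two-outcome POVM $\{E_0,E_1\}$ on $\mathcal{H}^{\otimes m}$ (outcome $0$: declare $H_0$; outcome $1$: declare $H_1$). ''Independent measurements'' means each of the $m$ copies is measured separately and the outcomes are classically processed. Type I error: $\alpha(M_m)=\mathrm{Tr}[\rho^{\otimes m}E_1]$; type II error (for the true state $\sigma$): $\beta(M_m)=\mathrm{Tr}[\sigma^{\otimes m}E_0]$. $\|X\|_1=\mathrm{Tr}\sqrt{X^\dagger X}$ is the trace norm. *)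

(* Defs.v *)
From HB Require Import structures.
From mathcomp Require Import all_boot all_order all_algebra.
From mathcomp Require Import boolp classical_sets reals.
From mathcomp Require Import sequences.
From mathcomp.analysis Require Import exp.
From mathcomp.real_closed Require Export complex mxtens.

Set Implicit Arguments.
Unset Strict Implicit.
Unset Printing Implicit Defensive.
Import Order.TTheory GRing.Theory Num.Theory.
Local Open Scope ring_scope.

Section Quantum.
Variable R : realType.
Local Notation C := R[i].

Definition adjmx {m n : nat} (A : 'M[C]_(m, n)) : 'M[C]_(n, m) :=
  (map_mx Num.conj A)^T.

Definition hermitian {n : nat} (A : 'M[C]_n) : Prop := adjmx A = A.

Definition psd {n : nat} (A : 'M[C]_n) : Prop :=
  hermitian A /\ forall v : 'cV[C]_n, 0 <= (adjmx v *m A *m v) 0 0.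

Definition density {n : nat} (A : 'M[C]_n) : Prop := psd A /\ \tr A = 1.

Definition psd_sqrt {n : nat} (A : 'M[C]_n) : 'M[C]_n :=
  xget 0 [set Y : 'M[C]_n | psd Y /\ Y *m Y = A].

Definition trnorm {n : nat} (X : 'M[C]_n) : R :=
  complex.Re (\tr (psd_sqrt (adjmx X *m X))).

Fixpoint ptens_rec (k : nat) : ('I_k.+1 -> 'M[C]_2) -> 'M[C]_(2 ^ k.+1) :=
  match k return ('I_k.+1 -> 'M[C]_2) -> 'M[C]_(2 ^ k.+1) with
  | 0 => fun f => f ord0
  | k'.+1 => fun f => f ord0 *t ptens_rec (fun i : 'I_k'.+1 => f (lift ord0 i))
  end.

Definition ptens (m : nat) : ('I_m -> 'M[C]_2) -> 'M[C]_(2 ^ m) :=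
  match m return ('I_m -> 'M[C]_2) -> 'M[C]_(2 ^ m) with
  | 0 => fun _ => 1
  | k.+1 => @ptens_rec k
  end.

Definition tpow (m : nat) (rho : 'M[C]_2) : 'M[C]_(2 ^ m) := ptens (fun _ : 'I_m => rho).

(* A decision rule on m copies built from independent measurements:
   copy i is measured with its own POVM {povm i j}_{j < nout} (finitely many
   outcomes), and the outcome string t is classically processed: H_0 is declared
   with probability dec t in [0,1] (randomized post-processing allowed). *)
Record indep_rule (m : nat) := IndepRule {
  nout : nat;
  povm : 'I_m -> 'I_nout -> 'M[C]_2;
  dec : {ffun 'I_m -> 'I_nout} -> R
}.

Arguments nout {m}. Arguments povm {m}. Arguments dec {m}.
Definition valid_indep_rule (m : nat) (M : indep_rule m) : Prop :=
  (forall i j, psd (povm M i j)) /\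
  (forall i, \sum_j povm M i j = 1) /\
  (forall t, 0 <= dec M t <= 1).

Definition E0 (m : nat) (M : indep_rule m) : 'M[C]_(2 ^ m) :=
  \sum_(t : {ffun 'I_m -> 'I_(nout M)})
     ((dec M t)%:C)%C *: ptens (fun i => povm M i (t i)).

Definition E1 (m : nat) (M : indep_rule m) : 'M[C]_(2 ^ m) := 1 - E0 M.

Definition type1_err (m : nat) (rho : 'M[C]_2) (M : indep_rule m) : R :=
  complex.Re (\tr (tpow m rho *m E1 M)).

Definition type2_err (m : nat) (sigma : 'M[C]_2) (M : indep_rule m) : R :=
  complex.Re (\tr (tpow m sigma *m E0 M)).

End Quantum.

(* Main.v *)
(** Each copy is measured with the six-outcome POVM made of the scaled eigenprojections of the
    three Pauli matrices, and [H_0] is declared when every outcome frequency is within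
    [O(sqrt m)] of its expectation under [rho]. Exponential moments with parameter [1 / sqrt m]
    give the type I bound. For the type II bound, let [p] and [q] be the outcome distributions
    of [rho] and [sigma], and [D] the sum of the [(p_j - q_j)^2]. Tilting along
    [(p_j - q_j) / 2] yields an exponent of at least [m D / 3], because no outcome has
    probability above 1/3. The three bases are mutually unbiased, so
    [D = Tr (rho - sigma)^2 / 9 >= trnorm (rho - sigma)^2 / 18], and [3 * 18 = 54]. *)
Require Import Defs.
From HB Require Import structures.
From mathcomp Require Import all_boot all_order all_algebra.
From mathcomp Require Import boolp classical_sets reals.
From mathcomp Require Import sequences.
From mathcomp.analysis Require Import exp.
From mathcomp.real_closed Require Import complex mxtens.
From mathcomp Require Import ring lra.
Import Order.TTheory GRing.Theory Num.Theory.
Local Open Scope ring_scope.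

(** Squaring [1 - x / 2 <= expR (- (x / 2))] gives [h ^+ 2 * expR x <= 1], while
    [h ^+ 2 * (1 + x + x ^+ 2)] exceeds 1 by [x ^+ 2 / 4 * (1 - 3 * x + x ^+ 2)]. This is where the
    threshold 1/3 comes from. *)
Lemma expR_le_quadratic (R : realType) (x : R) :
  x <= 1 / 3 -> expR x <= 1 + x + x ^+ 2.
Proof.
move=> x3; set h : R := 1 - x / 2.
have h0 : 0 < h by rewrite /h; lra.
have eh : h * expR (x / 2) <= 1.
  have := expR_ge1Dx (- (x / 2)); rewrite -/h => hle.
  by rewrite -[leRHS](expRxMexpNx_1 (x / 2)) [leRHS]mulrC ler_wpM2r ?expR_ge0.
have -> : expR x = expR (x / 2) ^+ 2.
  by rewrite expr2 -expRD; congr expR; field.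
have e2 : h ^+ 2 * expR (x / 2) ^+ 2 <= 1.
  by rewrite -exprMn expr_le1 // mulr_ge0 ?expR_ge0 ?ltW.
rewrite -(ler_pM2l (exprn_gt0 2 h0)) (le_trans e2) //.
have -> : h ^+ 2 * (1 + x + x ^+ 2) = 1 + x ^+ 2 / 4 * (1 - 3 * x + x ^+ 2).
  by rewrite /h; field.
by rewrite lerDl mulr_ge0 //; nra.
Qed.

(** * Classical frequency test on a finite alphabet *)

Section FrequencyTest.
Set Implicit Arguments.
Unset Strict Implicit.
Variables (R : realType) (J : finType).
Implicit Types (p q y : J -> R) (m : nat).

Definition distribution p := (forall j, 0 <= p j) /\ \sum_j p j = 1.

(** By independence the sum is the [m]-th power of the one-letter moment generating function, which
    is at most [1 + V <= expR V] because [y] is centred under [q]. *)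
Lemma sum_prod_expR q y V m :
  distribution q -> (forall j, y j <= 1 / 3) -> \sum_j q j * y j = 0 ->
  \sum_j q j * y j ^+ 2 <= V ->
  \sum_(t : {ffun 'I_m -> J}) (\prod_i q (t i)) * expR (\sum_i y (t i))
    <= expR (m%:R * V).
Proof.
move=> [q0 q1] y3 qy qyV.
under eq_bigr do rewrite expR_sum -big_split /=.
rewrite -(bigA_distr_bigA (fun _ j => q j * expR (y j))) prodr_const card_ord.
rewrite expRM_natl lerXn2r ?nnegrE ?expR_ge0 ?sumr_ge0 // => [j _|].
  by rewrite mulr_ge0 ?expR_ge0.
apply: le_trans (expR_ge1Dx V).
apply: (@le_trans _ _ (\sum_j (q j + q j * y j + q j * y j ^+ 2))).
  apply: ler_sum => j _; rewrite -{2}[q j]mulr1 -!mulrDr.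
  by rewrite ler_wpM2l // expR_le_quadratic.
by rewrite !big_split /= q1 qy addr0 lerD2l.
Qed.

(** Exponential Markov inequality: on [B] the factor [expR (\sum_i y (t i) - a)] is at least 1. *)
Lemma chernoff q y V a m (B : pred {ffun 'I_m -> J}) :
  distribution q -> (forall j, y j <= 1 / 3) -> \sum_j q j * y j = 0 ->
  \sum_j q j * y j ^+ 2 <= V -> (forall t, B t -> a <= \sum_i y (t i)) ->
  \sum_(t | B t) \prod_i q (t i) <= expR (m%:R * V - a).
Proof.
move=> dq y3 qy qyV By; have q0 t : 0 <= \prod_(i < m) q (t i).
  by apply: prodr_ge0 => i _; case: dq.
rewrite expRD; apply: (@le_trans _ _ (\sum_(t : {ffun 'I_m -> J})
    (\prod_i q (t i)) * expR (\sum_i y (t i)) * expR (- a))); last first.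
  by rewrite -mulr_suml ler_wpM2r ?expR_ge0 // sum_prod_expR.
rewrite big_mkcond ler_sum // => t _; rewrite -mulrA -expRD.
case: ifPn => [/By ay|_]; last by rewrite mulr_ge0 ?expR_ge0.
by rewrite ler_peMr // -expR0 ler_expR subr_ge0.
Qed.

Definition hits m (t : {ffun 'I_m -> J}) (j : J) : R := \sum_i (t i == j)%:R.

Definition accepts p (c : R) m (t : {ffun 'I_m -> J}) : bool :=
  [forall j, `|hits t j - m%:R * p j| <= c * Num.sqrt m%:R].

Lemma sum_hits m (t : {ffun 'I_m -> J}) y :
  \sum_i y (t i) = \sum_j hits t j * y j.
Proof.
under [RHS]eq_bigr do rewrite mulr_suml.
rewrite exchange_big; apply: eq_bigr => i _ /=.
rewrite (bigD1 (t i)) //= eqxx mul1r big1 ?addr0 // => j.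
by rewrite eq_sym => /negPf ->; rewrite mul0r.
Qed.

(** The sign [e] covers upper and lower deviations at once. *)
Lemma deviation_le p (c e : R) m (j : J) (B : pred {ffun 'I_m -> J}) :
  distribution p -> (9 <= m)%N -> e ^+ 2 = 1 ->
  (forall t, B t -> c * Num.sqrt m%:R <= e * (hits t j - m%:R * p j)) ->
  \sum_(t | B t) \prod_i p (t i) <= expR (1 - c).
Proof.
move=> dp m9 e1 Bc; have [p0 p1] := dp.
have pj1 : p j <= 1 by rewrite -p1 (bigD1 j) //= lerDl sumr_ge0.
have s9 : 3 <= Num.sqrt m%:R :> R.
  have <- : Num.sqrt (3 ^+ 2) = 3 :> R by rewrite sqrtr_sqr ger0_norm.
  by rewrite ler_wsqrtr // -natrX ler_nat.
have [s0 sN0] : 0 < Num.sqrt m%:R :> R /\ Num.sqrt m%:R != 0 :> R.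
  by split; [|apply: lt0r_neq0]; apply: lt_le_trans s9.
have ss : m%:R = Num.sqrt m%:R ^+ 2 :> R by rewrite sqr_sqrtr.
move: s9 s0 sN0 ss Bc; move: (Num.sqrt m%:R) => s s9 s0 sN0 ss Bc.
(* Scaling by [1 / s] makes the variance term [m * s ^- 2] equal to 1 and turns the threshold
   [c * s] into [c]; [s >= 3] keeps [y] below 1/3. *)
pose y k : R := e / s * ((k == j)%:R - p j).
have y2 k : y k ^+ 2 <= s ^- 2.
  rewrite /y exprMn expr_div_n e1 mul1r ler_piMr ?invr_ge0 ?exprn_ge0 ?(ltW s0) //.
  have := p0 j; case: (k == j); rewrite ?mulr1n ?mulr0n; nra.
have -> : 1 - c = m%:R * s ^- 2 - c by rewrite ss divff // expf_neq0.
apply: (@chernoff p y) => //.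
- move=> k; have s3 : s^-1 <= 1 / 3 by rewrite div1r lef_pV2 ?posrE.
  have : y k ^+ 2 <= (1 / 3) ^+ 2.
    apply: le_trans (y2 k) _; rewrite -exprVn.
    by rewrite lerXn2r ?nnegrE ?invr_ge0 ?(ltW s0) // divr_ge0.
  by case: (lerP (y k) (1 / 3)) => // y3; nra.
- rewrite /y; under eq_bigr do rewrite mulrCA mulrBr.
  rewrite -mulr_sumr big_split /= sumrN -mulr_suml p1 mul1r (bigD1 j) //=.
  rewrite eqxx mulr1 big1 ?addr0 ?subrr ?mulr0 // => k /negPf ->.
  by rewrite mulr0.
- apply: (@le_trans _ _ (\sum_k p k * s ^- 2)).
    by apply: ler_sum => k _; rewrite ler_wpM2l.
  by rewrite -mulr_suml p1 mul1r.
- move=> t /Bc; rewrite /y -mulr_sumr big_split /= sumr_const card_ord -/(hits t j).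
  rewrite mulNrn -[p j *+ m]mulr_natl => le_c.
  by rewrite mulrAC ler_pdivlMr.
Qed.

(** Union bound over the outcomes and the two signs of the deviation. *)
Lemma rejection_le p (alpha : R) m :
  distribution p -> 0 < alpha -> (9 <= m)%N ->
  \sum_(t : {ffun 'I_m -> J} | ~~ accepts p (1 + 2 * #|J|%:R / alpha) t)
     \prod_i p (t i) <= alpha.
Proof.
move=> dp a0 m9; set c := 1 + _; set n : R := #|J|%:R in c *.
pose B (e : R) j (t : {ffun 'I_m -> J}) :=
  c * Num.sqrt m%:R <= e * (hits t j - m%:R * p j).
have q0 t : 0 <= \prod_(i < m) p (t i).
  by apply: prodr_ge0 => i _; case: dp.
have Bc e j : e ^+ 2 = 1 -> \sum_(t | B e j t) \prod_i p (t i) <= expR (1 - c).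
  by move=> e1; apply: (@deviation_le p c e m j) => // t.
apply: (@le_trans _ _ (\sum_j (expR (1 - c) + expR (1 - c)))).
  apply: (@le_trans _ _ (\sum_j (\sum_(t | B 1 j t) \prod_i p (t i) +
                                 \sum_(t | B (-1) j t) \prod_i p (t i)))).
    under [leRHS]eq_bigr do rewrite [X in X + _]big_mkcond [X in _ + X]big_mkcond.
    under [leRHS]eq_bigr do rewrite -big_split.
    rewrite exchange_big [leLHS]big_mkcond /=; apply: ler_sum => t _.
    have ge0 j : 0 <= (if B 1 j t then \prod_i p (t i) else 0) +
                      (if B (-1) j t then \prod_i p (t i) else 0).
      by rewrite addr_ge0 //; case: ifP.
    case: ifPn => [|_]; last by rewrite sumr_ge0.
    rewrite negb_forall => /existsP[j]; rewrite -ltNge => gt_c.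
    rewrite (bigD1 j) //= -[leLHS]addr0 lerD ?sumr_ge0 //.
    have : B 1 j t || B (-1) j t.
      rewrite /B mul1r mulN1r; move: gt_c; case: ger0P => _ /ltW -> //.
      by rewrite orbT.
    by case/orP=> ->; [rewrite lerDl | rewrite lerDr]; case: ifP.
  by apply: ler_sum => j _; rewrite lerD // Bc // ?sqrrN expr1n.
rewrite sumr_const -mulr_natl -mulr2n -/n opprD addNKr.
(* The choice of [c] gives the form [alpha * (x * expR (- x))] with [x = 2 * n / alpha], and
   [x <= 1 + x <= expR x]. *)
have -> : n * (expR (- (2 * n / alpha)) *+ 2) =
          alpha * (2 * n / alpha * expR (- (2 * n / alpha))).
  by field; rewrite gt_eqF.
rewrite ler_piMr ?(ltW a0) // expRN ler_pdivrMr ?expR_gt0 // mul1r.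
by apply: le_trans (expR_ge1Dx _); rewrite lerDr.
Qed.

Lemma acceptance_le p q (c : R) m (D := \sum_j (p j - q j) ^+ 2) :
  0 <= c -> distribution p -> distribution q ->
  (forall j, p j <= 1 / 3) -> (forall j, q j <= 1 / 3) ->
  \sum_(t : {ffun 'I_m -> J} | accepts p c t) \prod_i q (t i) <=
    expR (- (m%:R * D) / 3 + c * (\sum_j `|p j - q j|) * Num.sqrt m%:R).
Proof.
move=> c0 [p0 p1] dq p3 q3; have [q0 q1] := dq.
pose d j := p j - q j; pose mu := \sum_j q j * d j.
(* Subtracting [mu] centres the tilt under [q]; since [d j <= 1 / 3] and [mu >= - (1 / 3)], [y]
   stays below 1/3. *)
pose y j := (d j - mu) / 2.
have d3 j : - (1 / 3) <= d j <= 1 / 3.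
  by rewrite /d; have := p0 j; have := q0 j; have := p3 j; have := q3 j; lra.
have D0 : 0 <= D by apply: sumr_ge0 => j _; rewrite sqr_ge0.
have mu3 : - (1 / 3) <= mu.
  have -> : 1 / 3 = \sum_j q j * (1 / 3) :> R by rewrite -mulr_suml q1 !mul1r.
  rewrite -sumrN ler_sum // => j _.
  by rewrite -mulrN ler_wpM2l //; case/andP: (d3 j).
have qd2 : \sum_j q j * d j ^+ 2 <= D / 3.
  rewrite mulr_suml ler_sum // => j _; rewrite [leRHS]mulrC.
  by rewrite ler_wpM2r ?sqr_ge0 // -div1r.
set a := m%:R * D / 2 - c * Num.sqrt m%:R * (\sum_j `|d j|) / 2.
(* The variance of [y] under [q] is at most a quarter of [\sum_j q j * d j ^+ 2 <= D / 3]. *)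
have Hc := @chernoff q y (D / 12) a m (@accepts p c m) dq.
apply: le_trans (Hc _ _ _ _) _.
- by move=> j; have := d3 j; rewrite /y; lra.
- rewrite /y; under eq_bigr do rewrite mulrA mulrBr.
  by rewrite -mulr_suml big_split /= sumrN -mulr_suml q1 mul1r subrr mul0r.
- apply: (@le_trans _ _ (\sum_j (q j * d j ^+ 2 / 4 - q j * d j * mu / 2 +
                                 q j * mu ^+ 2 / 4))).
    rewrite le_eqVlt; apply/orP; left; apply/eqP.
    by apply: eq_bigr => j _; rewrite /y; field.
  rewrite !big_split /= sumrN -!mulr_suml -/mu q1.
  have := sqr_ge0 mu; move: qd2; rewrite expr2; lra.
- move=> t /forallP acc.
  rewrite sum_hits.
  have -> : \sum_j hits t j * y j =
      (\sum_j (hits t j - m%:R * p j) * d j + m%:R * D) / 2.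
    rewrite /y /D.
    have hm : \sum_j hits t j = m%:R.
      under eq_bigr do rewrite -[hits t _]mulr1.
      by rewrite -(sum_hits t (fun=> 1)) sumr_const card_ord.
    have -> : \sum_j hits t j * ((d j - mu) / 2) =
       (\sum_j hits t j * d j - m%:R * mu) / 2.
      rewrite -hm [X in _ - X]mulr_suml -sumrB mulr_suml.
      by apply: eq_bigr => j _; field.
    congr (_ / 2); rewrite /mu !mulr_sumr -sumrB -big_split /=.
    by apply: eq_bigr => j _; rewrite /d; ring.
  rewrite /a -mulrBl ler_pM2r ?invr_gt0 // addrC lerD2r mulr_sumr -sumrN.
  apply: ler_sum => j _.
  have : `|(hits t j - m%:R * p j) * d j| <= c * Num.sqrt m%:R * `|d j|.
    by rewrite normrM ler_wpM2r.
  by rewrite ler_norml => /andP[].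
(* The exponent obtained is [m * D * (1/12 - 1/2)], that is -5/12 of [m * D], weakened to -1/3; the
   [sqrt m] term is doubled. *)
have mD : 0 <= m%:R * D by rewrite mulr_ge0.
have cS : 0 <= c * Num.sqrt m%:R * (\sum_j `|d j|).
  by rewrite !mulr_ge0 ?sqrtr_ge0 // sumr_ge0.
rewrite ler_expR (mulrAC c).
by move: cS; rewrite /a /d; lra.
Qed.

End FrequencyTest.

(** * Traces and products of tensor products *)

Lemma mxtrace_tens (K : comPzRingType) m n (A : 'M[K]_m) (B : 'M[K]_n) :
  \tr (A *t B) = \tr A * \tr B.
Proof.
rewrite /mxtrace mulr_sum; apply: eq_bigr => k _.
by case: (mxtens_indexP k) => i j; rewrite tensmxE mxtens_indexK.
Qed.

Lemma mxtrace_ptens (R : realType) m (f : 'I_m -> 'M[R[i]]_2) :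
  \tr (ptens f) = \prod_i \tr (f i).
Proof.
case: m f => [|m] f; first by rewrite /ptens mxtrace1 big_ord0.
rewrite /ptens; elim: m f => [|m IH] f; first by rewrite big_ord1.
by rewrite big_ord_recl -IH -mxtrace_tens.
Qed.

Lemma ptensM (R : realType) m (f g : 'I_m -> 'M[R[i]]_2) :
  ptens f *m ptens g = ptens (fun i => f i *m g i).
Proof.
case: m f g => [|m] f g; first by rewrite mul1mx.
by rewrite /ptens; elim: m f g => [//|m IH] f g /=; rewrite -IH -tensmx_mul.
Qed.

(** * The Pauli measurement and its outcome distribution *)

Section MubPovm.
Variable R : realType.
Set Implicit Arguments.
Unset Strict Implicit.
Local Notation C := R[i].

Lemma adjmxE m n (A : 'M[C]_(m, n)) i j : adjmx A i j = ((A j i)^*)%C.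
Proof. by rewrite !mxE. Qed.

Lemma adjmxM m n p (A : 'M[C]_(m, n)) (B : 'M[C]_(n, p)) :
  adjmx (A *m B) = adjmx B *m adjmx A.
Proof. by rewrite /adjmx map_mxM trmx_mul. Qed.

Lemma adjmxK m n (A : 'M[C]_(m, n)) : adjmx (adjmx A) = A.
Proof. by apply/matrixP => i j; rewrite !adjmxE conjcK. Qed.

Lemma mxtrace_rank1 n (A : 'M[C]_n) (u : 'cV[C]_n) :
  \tr (A *m (u *m adjmx u)) = (adjmx u *m A *m u) 0 0.
Proof. by rewrite mulmxA mxtrace_mulC mulmxA /mxtrace big_ord1. Qed.

Lemma psd_rank1 n (c : R) (u : 'cV[C]_n) :
  0 <= c -> psd (c%:C%C *: (u *m adjmx u)).
Proof.
move=> c0; split=> [|v].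
  apply/matrixP => i j; rewrite adjmxE [X in (X^*)%C]mxE [RHS]mxE rmorphM /=.
  by rewrite oppr0 -adjmxE adjmxM adjmxK.
rewrite -scalemxAr -scalemxAl mxE mulr_ge0 ?ler0c //.
have -> : adjmx v *m (u *m adjmx u) *m v =
   (adjmx v *m u) *m adjmx (adjmx v *m u).
  by rewrite adjmxM adjmxK !mulmxA.
by rewrite mxE big_ord1 adjmxE mulcJ_ge0.
Qed.

(* Unnormalised eigenvectors of the Pauli matrices X, Y, Z; the entry 1 + i has squared
   modulus 2, so that all six vectors have squared norm 2. *)
Definition mub_vec (j : 'I_6) : 'cV[C]_2 :=
  \col_k (if k == 0 then nth 0 [:: 1; 1; 1; 1; (1 +i* 1)%C; 0] j
          else nth 0 [:: 1; -1; 'i%C; - 'i%C; 0; (1 +i* 1)%C] j).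

(** The factor 1/6 is 1/2 to normalise the projection times 1/3 for each of the three bases. *)
Definition mub_povm (j : 'I_6) : 'M[C]_2 :=
  (6^-1)%:C%C *: (mub_vec j *m adjmx (mub_vec j)).

Definition born (s : 'M[C]_2) (j : 'I_6) : R :=
  complex.Re (\tr (s *m mub_povm j)).

Lemma psd_mub_povm j : psd (mub_povm j).
Proof. by apply: psd_rank1; rewrite invr_ge0. Qed.

Lemma mub_povm_pair j : exists k, mub_povm j + mub_povm k = (3^-1)%:C%C%:M.
Proof.
(* The two eigenvectors of one Pauli matrix have indices [2k] and [2k + 1]. *)
exists (inord (if odd j then j.-1 else j.+1)); apply/matrixP => a b.
rewrite !mxE !big_ord1 !adjmxE !mxE.
by case: j => [[|[|[|[|[|[|//]]]]]] hj]; rewrite /= inordK //=;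
  case: a => [[|[|//]] ha]; case: b => [[|[|//]] hb] /=;
  rewrite ?mulr1n ?mulr0n; apply/eqP; rewrite eq_complex /=;
  apply/andP; split; apply/eqP; field.
Qed.

Lemma sum_mub_povm : \sum_j mub_povm j = 1.
Proof.
apply/matrixP => a b.
rewrite !big_ord_recl big_ord0 !mxE !big_ord1 !adjmxE !mxE /=.
by case: a => [[|[|//]] ha]; case: b => [[|[|//]] hb] /=;
  rewrite ?mulr1n ?mulr0n; apply/eqP; rewrite eq_complex /=;
  apply/andP; split; apply/eqP; field.
Qed.

Lemma sum_ord2 (V : zmodType) (F : 'I_2 -> V) : \sum_i F i = F 0 + F 1.
Proof.
by rewrite !big_ord_recl big_ord0 addr0; congr (F _ + F _); apply/val_inj.
Qed.

Lemma hermitian2P (A : 'M[C]_2) : Defs.hermitian A ->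
  exists a d x y : R, [/\ A 0 0 = a%:C%C, A 1 1 = d%:C%C,
    A 0 1 = (x +i* y)%C & A 1 0 = (x -i* y)%C].
Proof.
move=> hA; have h i j : A i j = ((A j i)^*)%C.
  by rewrite -[LHS](congr1 (fun B : 'M[C]_2 => B i j) hA) adjmxE.
exists (complex.Re (A 0 0)), (complex.Re (A 1 1)).
exists (complex.Re (A 0 1)), (complex.Im (A 0 1)).
have := h 0 0; have := h 1 1; rewrite (h 1 0).
case: (A 0 0) (A 1 1) (A 0 1) => [a a'] [d d'] [x y] [] ed [] ea /=.
by split=> //; congr (_ +i* _)%C; lra.
Qed.

(** Nonnegativity in [R[i]] includes being real, so the real part in [born] loses nothing. *)
Lemma mxtrace_psd_mub (s : 'M[C]_2) j :
  psd s -> 0 <= born s j /\ \tr (s *m mub_povm j) = (born s j)%:C%C.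
Proof.
move=> [_ s0].
have t0 : 0 <= \tr (s *m mub_povm j).
  by rewrite -scalemxAr mxtraceZ mxtrace_rank1 mulr_ge0 // ler0c invr_ge0.
have e : (born s j)%:C%C = \tr (s *m mub_povm j).
  by rewrite /born RRe_real ?ger0_real.
by rewrite -ler0c e.
Qed.

Lemma born_distribution (s : 'M[C]_2) : density s -> distribution (born s).
Proof.
move=> [ps s1]; split=> [j|]; first by have [] := mxtrace_psd_mub j ps.
rewrite /born -raddf_sum -raddf_sum /=.
by rewrite -mulmx_sumr sum_mub_povm mulmx1 s1.
Qed.

(** An outcome and its partner in the same basis share total probability 1/3. *)
Lemma born_le (s : 'M[C]_2) j : density s -> born s j <= 1 / 3.
Proof.
move=> ds; have [ps s1] := ds; have [k jk] := mub_povm_pair j.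
have [k0 _] := mxtrace_psd_mub k ps.
have <- : born s j + born s k = 1 / 3.
  rewrite /born -raddfD -raddfD /= -mulmxDr jk mul_mx_scalar mxtraceZ s1 mulr1.
  by rewrite /= div1r.
by rewrite lerDl.
Qed.

Lemma bornB (s t : 'M[C]_2) j : born (s - t) j = born s j - born t j.
Proof. by rewrite /born mulmxBl !raddfB. Qed.

Lemma born_coord (A : 'M[C]_2) (a d x y : R) j :
  A 0 0 = a%:C%C -> A 1 1 = d%:C%C ->
  A 0 1 = (x +i* y)%C -> A 1 0 = (x -i* y)%C ->
  born A j = nth 0 [:: a + d + 2 * x; a + d - 2 * x; a + d - 2 * y;
                       a + d + 2 * y; 2 * a; 2 * d] j / 6.
Proof.
move=> e00 e11 e01 e10.
rewrite /born -scalemxAr mxtraceZ mxtrace_rank1 !mxE sum_ord2 !mxE !sum_ord2.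
rewrite !adjmxE !mxE e00 e11 e01 e10 /=.
by case: j => [[|[|[|[|[|[|//]]]]]] hj] /=; field.
Qed.

(** Without trace the six values are plus and minus a third of the Bloch coordinates [x], [y], [a],
    while the trace of [A *m A] is [2 * (a ^+ 2 + x ^+ 2 + y ^+ 2)]. *)
Lemma sum_born_sqr (A : 'M[C]_2) : Defs.hermitian A -> \tr A = 0 ->
  \sum_j born A j ^+ 2 = complex.Re (\tr (adjmx A *m A)) / 9.
Proof.
move=> hA; have [a [d [x [y [e00 e11 e01 e10]]]]] := hermitian2P hA.
rewrite hA /mxtrace !sum_ord2 !mxE !sum_ord2.
rewrite !big_ord_recl big_ord0 !(born_coord _ e00 e11 e01 e10) /=.
rewrite e00 e11 e01 e10 => -[] da _ /=.
have -> : d = - a by lra.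
by field.
Qed.

(* An upper bound on [trnorm] needs no uniqueness of the square root: any Hermitian [Y]
   satisfies [(\tr Y)^2 <= 2 \tr (Y^2)], and if none existed [psd_sqrt] would be 0. *)
Lemma trnorm_sqr_le (A : 'M[C]_2) :
  trnorm A ^+ 2 <= 2 * complex.Re (\tr (adjmx A *m A)).
Proof.
rewrite /trnorm /psd_sqrt; case: xgetP => [Y _ [[hY _] <-]|_].
  have [a [d [x [y [e00 e11 e01 e10]]]]] := hermitian2P hY.
  rewrite /mxtrace !sum_ord2 !mxE !sum_ord2 e00 e11 e01 e10 /=.
  rewrite -subr_ge0 [X in 0 <= X](_ : _ = (a - d) ^+ 2 + 4 * (x ^+ 2 + y ^+ 2)).
    by rewrite addr_ge0 ?sqr_ge0 // mulr_ge0 // addr_ge0 ?sqr_ge0.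
  by ring.
rewrite mxtrace0 /= expr0n /= mulr_ge0 // /mxtrace raddf_sum sumr_ge0 // => i _.
rewrite mxE raddf_sum sumr_ge0 // => k _; rewrite adjmxE /=.
by case: (A k i) => u v /=; nra.
Qed.

(** * The quantum test and its errors as classical probabilities *)

Definition mub_test (rho : 'M[C]_2) (alpha : R) (m : nat) : indep_rule R m :=
  IndepRule (fun _ j => mub_povm j)
    (fun t => (accepts (born rho) (1 + 2 * #|'I_6|%:R / alpha) t)%:R).

Lemma valid_mub_test rho alpha m : valid_indep_rule (mub_test rho alpha m).
Proof.
split=> [i j|]; first exact: psd_mub_povm.
by split=> [i|t] /=; [exact: sum_mub_povm | case: accepts; rewrite ?ler01 ?lexx].
Qed.

Lemma type2_mub_test (rho sigma : 'M[C]_2) alpha m : density sigma ->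
  type2_err sigma (mub_test rho alpha m) =
  \sum_(t | accepts (born rho) (1 + 2 * #|'I_6|%:R / alpha) t)
     \prod_(i < m) born sigma (t i).
Proof.
move=> [ps _]; rewrite /type2_err /E0 mulmx_sumr.
rewrite [\tr _]raddf_sum [LHS]raddf_sum [RHS]big_mkcond /=.
apply: eq_bigr => t _.
rewrite -scalemxAr mxtraceZ /tpow ptensM mxtrace_ptens.
under eq_bigr do rewrite (mxtrace_psd_mub _ ps).2.
rewrite -rmorph_prod -rmorphM /=.
by case: ifP => _; rewrite ?mul1r ?mul0r.
Qed.

(** The outcome strings have total probability 1, so [1 - E0] carries the rejected ones. *)
Lemma type1_mub_test (rho : 'M[C]_2) alpha m : density rho ->
  type1_err rho (mub_test rho alpha m) =
  \sum_(t | ~~ accepts (born rho) (1 + 2 * #|'I_6|%:R / alpha) t)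
     \prod_(i < m) born rho (t i).
Proof.
move=> drho; have [_ rho1] := drho; have [_ p1] := born_distribution drho.
rewrite /type1_err /E1 mulmxBr mulmx1 !raddfB /= -/(type2_err rho _).
rewrite type2_mub_test // /tpow mxtrace_ptens big1 //=.
set acc := accepts _ _.
have : \sum_(t : {ffun 'I_m -> 'I_6}) \prod_(i < m) born rho (t i) = 1.
  by rewrite -(bigA_distr_bigA (fun _ j => born rho j)) p1 prodr_const expr1n.
rewrite (bigID (@acc m)) /=.
by move: (\sum_(t | acc m t) _) (\sum_(t | ~~ acc m t) _) => A B; lra.
Qed.

End MubPovm.

Theorem theorem2 (R : realType) (rho : 'M[R[i]]_2) (alpha : R) :
  density rho -> 0 < alpha < 1 ->
  exists M : forall m : nat, indep_rule R m,
    (forall m, valid_indep_rule (M m)) /\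
    (exists m0 : nat, forall m : nat, (m0 <= m)%N -> type1_err rho (M m) <= alpha) /\
    (forall sigma : 'M[R[i]]_2, density sigma -> sigma <> rho ->
       exists K : R, exists m0 : nat, forall m : nat, (m0 <= m)%N ->
         type2_err sigma (M m) <=
           expR (- (m%:R * trnorm (rho - sigma) ^+ 2) / 54 + K * Num.sqrt m%:R)).
Proof.
move=> drho /andP[a0 _]; exists (mub_test rho alpha).
split=> [m|]; first exact: valid_mub_test.
split=> [|sigma dsigma _].
  exists 9%N => m m9; rewrite type1_mub_test //.
  by apply: rejection_le => //; apply: born_distribution.
(* [K] is the coefficient of [sqrt m] in [acceptance_le], a bound valid for every [m]. *)
exists ((1 + 2 * #|'I_6|%:R / alpha) * \sum_j `|born rho j - born sigma j|), 0%N.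
move=> m _; rewrite type2_mub_test //.
have c0 : 0 <= 1 + 2 * #|'I_6|%:R / alpha.
  by rewrite addr_ge0 // divr_ge0 ?mulr_ge0 ?(ltW a0).
apply: le_trans (acceptance_le _ c0 (born_distribution drho)
  (born_distribution dsigma) (fun j => born_le j drho) (fun j => born_le j dsigma)) _.
rewrite ler_expR lerD2r !mulNr lerN2.
have [[[hr _] r1] [[hs _] s1]] := (drho, dsigma).
have hB : Defs.hermitian (rho - sigma).
  by rewrite /Defs.hermitian /adjmx map_mxB linearB /= -!/(adjmx _) hr hs.
have tB : \tr (rho - sigma) = 0 by rewrite raddfB /= r1 s1 subrr.
have := sum_born_sqr hB tB; under eq_bigr do rewrite bornB.
move=> ->; have := trnorm_sqr_le (rho - sigma).
(* What remains is [m * u / 54 <= m * (v / 9) / 3], which follows from [u <= 2 * v]. *)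
have m0 := ler0n R m; move: (trnorm _ ^+ 2) (complex.Re _) => u v uv.
have := ler_wpM2l m0 uv; lra.
Qed.
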